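(* Let $u_0:\mathbb{R}\to\mathbb{R}$ be given by $u_0(x)=1$ for $x\le 0$ and $u_0(x)=0$ for $x>0$. Define the Eulerian solution manifold $$\mathcal{M}_E=\{\,x\mapsto u_0(x-t) : t\in[0,1]\,\}\subset L^2([0,1])$$ and the Lagrangian solution manifold $$\mathcal{M}_L=\left\{\ \hat{x}\mapsto\begin{pmatrix}\hat{x}+t\\ u_0(\hat{x})\end{pmatrix} : t\in[0,1]\right\}\subset L^2([0,1];\mathbb{R}^2).$$ Then: (i) there exists a constant $c>0$ such that for all integers $n\ge 1$, $d_n(\mathcal{M}_E)\ge c\,n^{-1/2}$, where $d_n(\mathcal{M}_E)$ is the Kolmogorov $n$-width in $L^2([0,1])$; (ii) for all integers $n\ge 2$, $d_n(\mathcal{M}_L)=0$, where $d_n(\mathcal{M}_L)$ is the Kolmogorov $n$-width in $L^2([0,1];\mathbb{R}^2)$.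
   Context: For a subset $\mathcal{M}$ of a normed space $X$, the Kolmogorov $n$-width of $\mathcal{M}$ in $X$ is $$d_n(\mathcal{M})=\inf_{\substack{\mathcal{V}_n\subset X\\ \dim \mathcal{V}_n=n}}\ \sup_{u\in\mathcal{M}}\ \inf_{v\in\mathcal{V}_n}\|u-v\|_X,$$ the outer infimum being over $n$-dimensional linear subspaces. The space $L^2([0,1];\mathbb{R}^2)$ carries the norm $\|(v_1,v_2)\|=\left(\int_0^1[v_1(\hat{x})^2+v_2(\hat{x})^2]\,d\hat{x}\right)^{1/2}$. Background: $\mathcal{M}_E$ is the set of time slices of the solution $u(x,t)=u_0(x-t)$ of $\partial_t u+\partial_x u=0$ on $(x,t)\in[0,1]^2$ with $u(x,0)=0$, $u(0,t)=1$. $\mathcal{M}_L$ collects the characteristic line $\chi(\hat{x},t)=\hat{x}+t$ (solving $d\chi/dt=1$, $\chi(\hat{x},0)=\hat{x}$) together with the solution value $u_0(\hat{x})$ along it. *)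

(* Defs.v *)
From HB Require Import structures.
From mathcomp Require Import all_boot all_order all_algebra generic_quotient.
From mathcomp Require Import all_classical all_reals all_analysis measurable_realfun.
From mathcomp Require Import ring lra.

Set Implicit Arguments.
Unset Strict Implicit.
Unset Printing Implicit Defensive.

Import Order.TTheory GRing.Theory Num.Theory.
Import numFieldNormedType.Exports.

Local Open Scope classical_set_scope.
Local Open Scope ring_scope.

Section KolmogorovWidth.
Context {R : realType} {X : normedModType R}.
Implicit Types (V M : set X).

Definition lin_indep n (b : 'I_n -> X) : Prop :=
  forall a : 'I_n -> R, \sum_(i < n) a i *: b i = 0 -> forall i, a i = 0.

Definition lin_span n (b : 'I_n -> X) : set X :=
  [set v | exists a : 'I_n -> R, v = \sum_(i < n) a i *: b i].

Definition subspace_of_dim (n : nat) : set (set X) :=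
  [set V | exists b : 'I_n -> X, lin_indep b /\ V = lin_span b].

(* Extended-real infima and suprema, so that no boundedness side condition
   is needed; all the norms involved are nonnegative. *)
Definition dist_to_set V (u : X) : \bar R :=
  ereal_inf [set (`|u - v|)%:E | v in V].

Definition deviation M V : \bar R :=
  ereal_sup [set dist_to_set V u | u in M].

Definition kolmogorov_width (n : nat) M : \bar R :=
  ereal_inf [set deviation M V | V in subspace_of_dim n].

End KolmogorovWidth.

Record seminorm (R : realType) (V : lmodType R) := Seminorm {
  seminorm_fun :> V -> R ;
  seminormD : forall x y, seminorm_fun (x + y) <= seminorm_fun x + seminorm_fun y ;
  seminormZ : forall a x, seminorm_fun (a *: x) = `|a| * seminorm_fun x }.

(* The normed space obtained from a seminormed space by identifying x and y
   when x - y has seminorm 0.  With the L^2 seminorms below this is the usual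
   passage from square-integrable functions to their classes modulo almost
   everywhere equality. *)
Section NormedQuotient.
Local Open Scope quotient_scope.
Context (R : realType) (V : lmodType R) (p : seminorm V).
Implicit Types (x y z : V) (a : R).

Let p0 : p 0 = 0.
Proof. by rewrite -(scale0r 0) seminormZ normr0 mul0r. Qed.

Let pN x : p (- x) = p x.
Proof. by rewrite -scaleN1r seminormZ normrN1 mul1r. Qed.

Let p_ge0 x : 0 <= p x.
Proof.
have := seminormD p x (- x); rewrite subrr p0 pN -mulr2n.
by rewrite pmulrn_lge0.
Qed.

Definition null_eq : rel V := [rel x y | p (x - y) == 0].

Let null_eqP x y : reflect (p (x - y) = 0) (null_eq x y).
Proof. exact: eqP. Qed.

Let p_eq0D x y : p x = 0 -> p y = 0 -> p (x + y) = 0.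
Proof.
move=> x0 y0; apply/le_anti; rewrite p_ge0 andbT.
by have := seminormD p x y; rewrite x0 y0 addr0.
Qed.

Let null_eq_refl : reflexive null_eq.
Proof. by move=> x; apply/null_eqP; rewrite subrr. Qed.

Let null_eq_sym : symmetric null_eq.
Proof. by move=> x y; rewrite /null_eq /= -opprB pN. Qed.

Let null_eq_trans : transitive null_eq.
Proof.
move=> y x z /null_eqP xy /null_eqP yz; apply/null_eqP.
by rewrite -(subrKA y) p_eq0D.
Qed.

Canonical null_eq_equiv :=
  EquivRel null_eq null_eq_refl null_eq_sym null_eq_trans.

Definition nquot : Type := {eq_quot null_eq}.
HB.instance Definition _ := Choice.on nquot.
HB.instance Definition _ := EqQuotient.on nquot.

Definition nclass (x : V) : nquot := \pi_nquot x.

Lemma nclassP x y : nclass x = nclass y <-> p (x - y) = 0.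
Proof.
split=> [/eqmodP/null_eqP //|xy]; apply/eqmodP; exact/null_eqP.
Qed.

Let nrepr (u : nquot) : V := repr u.

Let nreprK u : nclass (nrepr u) = u.
Proof. exact: reprK. Qed.

Let nclassK x : p (nrepr (nclass x) - x) = 0.
Proof. by apply/nclassP; rewrite nreprK. Qed.

Definition nquot_add (u v : nquot) := nclass (nrepr u + nrepr v).
Definition nquot_opp (u : nquot) := nclass (- nrepr u).
Definition nquot_scale a (u : nquot) := nclass (a *: nrepr u).
Definition nquot_norm (u : nquot) : R := p (nrepr u).

Let addE x y : nquot_add (nclass x) (nclass y) = nclass (x + y).
Proof. by apply/nclassP; rewrite opprD addrACA p_eq0D. Qed.

Let oppE x : nquot_opp (nclass x) = nclass (- x).
Proof. by apply/nclassP; rewrite -opprD pN. Qed.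

Let scaleE a x : nquot_scale a (nclass x) = nclass (a *: x).
Proof. by apply/nclassP; rewrite -scalerBr seminormZ nclassK mulr0. Qed.

Let normE x : nquot_norm (nclass x) = p x.
Proof.
have h y z : p (y - z) = 0 -> p y <= p z.
  by move=> yz; have := seminormD p (y - z) z; rewrite subrK yz add0r.
apply/le_anti/andP; split; apply: h; first exact: nclassK.
by rewrite -opprB pN nclassK.
Qed.

Let nquotW (P : nquot -> Prop) : (forall x, P (nclass x)) -> forall u, P u.
Proof. by move=> h u; rewrite -(nreprK u). Qed.

Let addA : associative nquot_add.
Proof.
by elim/nquotW => x; elim/nquotW => y; elim/nquotW => z; rewrite !addE addrA.
Qed.

Let addC : commutative nquot_add.
Proof. by elim/nquotW => x; elim/nquotW => y; rewrite !addE addrC. Qed.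

Let add0 : left_id (nclass 0) nquot_add.
Proof. by elim/nquotW => x; rewrite addE add0r. Qed.

Let addN : left_inverse (nclass 0) nquot_opp nquot_add.
Proof. by elim/nquotW => x; rewrite oppE addE addNr. Qed.

HB.instance Definition _ := GRing.isZmodule.Build nquot addA addC add0 addN.

Let scaleA a b u : nquot_scale a (nquot_scale b u) = nquot_scale (a * b) u.
Proof. by elim/nquotW: u => x; rewrite !scaleE scalerA. Qed.

Let scale1 : left_id 1 nquot_scale.
Proof. by elim/nquotW => x; rewrite scaleE scale1r. Qed.

Let scaleDr : right_distributive nquot_scale +%R.
Proof.
move=> a; elim/nquotW => x; elim/nquotW => y.
by rewrite /GRing.add/= addE !scaleE addE scalerDr.
Qed.

Let scaleDl u : {morph nquot_scale^~ u : a b / a + b}.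
Proof.
move=> a b; elim/nquotW: u => x.
by rewrite /GRing.add/= !scaleE addE -scalerDl.
Qed.

HB.instance Definition _ :=
  GRing.Zmodule_isLmodule.Build R nquot scaleA scale1 scaleDr scaleDl.

Let normD u v : nquot_norm (u + v) <= nquot_norm u + nquot_norm v.
Proof.
elim/nquotW: u => x; elim/nquotW: v => y.
by rewrite /GRing.add/= addE !normE seminormD.
Qed.

Let normZ a u : nquot_norm (a *: u) = `|a| * nquot_norm u.
Proof. by elim/nquotW: u => x; rewrite /GRing.scale/= scaleE !normE seminormZ. Qed.

Let norm_eq0 u : nquot_norm u = 0 -> u = 0.
Proof.
elim/nquotW: u => x; rewrite normE => x0.
by apply/nclassP; rewrite subr0.
Qed.

HB.instance Definition _ :=
  Lmodule_isNormed.Build R nquot normD normZ norm_eq0.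

Lemma nclassD x y : nclass (x + y) = nclass x + nclass y.
Proof. by rewrite [RHS]addE. Qed.

Lemma nclassZ a x : nclass (a *: x) = a *: nclass x.
Proof. by rewrite [RHS]scaleE. Qed.

Lemma norm_nclass x : `|nclass x| = p x.
Proof. exact: normE. Qed.

End NormedQuotient.

Section L2.
Context d (T : measurableType d) (R : realType) (mu : {measure set T -> \bar R}).

Definition Lfun2 := LfunType mu (lee1n 2).

Definition L2norm (f : Lfun2) : R := fine ('N[mu]_2%:E[EFin \o f])%E.

Let L2normD (f g : Lfun2) : L2norm (f + g) <= L2norm f + L2norm g.
Proof. exact: ler_LnormD. Qed.

Let L2normZ a (f : Lfun2) : L2norm (a *: f) = `|a| * L2norm f.
Proof.
by rewrite /L2norm (LnormZ f a) -(finite_norm_fine f) -EFinM.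
Qed.

Definition L2seminorm := Seminorm L2normD L2normZ.

(* The pair (f.1, f.2) stands for the R^2-valued function x |-> (f.1 x, f.2 x). *)
Definition L2pair_norm (f : Lfun2 * Lfun2) : R :=
  Num.sqrt (\int[mu]_x (f.1 x ^+ 2 + f.2 x ^+ 2)).

Lemma L2norm_ge0 (f : Lfun2) : 0 <= L2norm f.
Proof. by rewrite fine_ge0 ?Lnorm_ge0. Qed.

Let Lfun2_sqr_integrable (f : Lfun2) :
  mu.-integrable [set: T] (EFin \o (fun x => f x ^+ 2)).
Proof. by apply: Lfun2_integrable_sqr; exact: LfunP. Qed.

Lemma L2norm_sqr (f : Lfun2) : L2norm f ^+ 2 = \int[mu]_x (f x ^+ 2).
Proof.
apply: EFin_inj; rewrite EFin_expe [X in (X ^+ 2)%E]finite_norm_fine.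
have -> : ('N[mu]_2%:E[EFin \o f] ^+ 2 = 'N[mu]_2%:E[EFin \o f] `^ 2)%E.
  by rewrite -(finite_norm_fine f) poweR_EFin -EFin_expe powR_mulrn// L2norm_ge0.
rewrite powR_Lnorm// /Rintegral fineK; last first.
  exact: integrable_fin_num (Lfun2_sqr_integrable f).
by apply: eq_integral => x _ /=; rewrite powR_mulrn// -normrX ger0_norm// sqr_ge0.
Qed.

Lemma L2pair_normE (f : Lfun2 * Lfun2) :
  L2pair_norm f = Num.sqrt (L2norm f.1 ^+ 2 + L2norm f.2 ^+ 2).
Proof. by rewrite /L2pair_norm RintegralD// !L2norm_sqr. Qed.

Let L2pair_normD f g : L2pair_norm (f + g) <= L2pair_norm f + L2pair_norm g.
Proof.
rewrite !L2pair_normE.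
have := L2normD f.1 g.1; have := L2normD f.2 g.2.
have := L2norm_ge0 (f + g).1; have := L2norm_ge0 (f + g).2.
have := L2norm_ge0 f.1; have := L2norm_ge0 f.2.
have := L2norm_ge0 g.1; have := L2norm_ge0 g.2.
rewrite /=; move: (L2norm _) (L2norm _) (L2norm _) (L2norm _) (L2norm _) (L2norm _).
move=> s1 s2 f1 f2 g1 g2 g2_0 g1_0 f2_0 f1_0 s2_0 s1_0 s2le s1le.
rewrite -[leRHS]ger0_norm ?addr_ge0 ?sqrtr_ge0// -sqrtr_sqr ler_wsqrtr//.
rewrite sqrrD !sqr_sqrtr ?addr_ge0 ?sqr_ge0//.
have cs : f1 * g1 + f2 * g2 <=
    Num.sqrt (f1 ^+ 2 + f2 ^+ 2) * Num.sqrt (g1 ^+ 2 + g2 ^+ 2).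
  rewrite -sqrtrM ?addr_ge0 ?sqr_ge0//.
  rewrite -[leLHS]ger0_norm ?addr_ge0 ?mulr_ge0// -sqrtr_sqr ler_wsqrtr//.
  rewrite -subr_ge0 (_ : _ - _ = (f1 * g2 - f2 * g1) ^+ 2) ?sqr_ge0//; ring.
have s1s : s1 ^+ 2 <= (f1 + g1) ^+ 2 by rewrite lerXn2r ?nnegrE ?addr_ge0.
have s2s : s2 ^+ 2 <= (f2 + g2) ^+ 2 by rewrite lerXn2r ?nnegrE ?addr_ge0.
move: cs; set q := _ * Num.sqrt _ => cs.
lra.
Qed.

Let L2pair_normZ a f : L2pair_norm (a *: f) = `|a| * L2pair_norm f.
Proof.
rewrite !L2pair_normE /= !L2normZ !exprMn -mulrDr sqrtrM ?sqr_ge0//.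
by rewrite sqrtr_sqr normr_id.
Qed.

Definition L2pair_seminorm := Seminorm L2pair_normD L2pair_normZ.

Definition L2space : normedModType R := nquot L2seminorm.

Definition L2pair_space : normedModType R := nquot L2pair_seminorm.

Definition L2class (f : Lfun2) : L2space := nclass L2seminorm f.

Definition L2pair_class (f : Lfun2 * Lfun2) : L2pair_space :=
  nclass L2pair_seminorm f.

Lemma norm_L2class f : `|L2class f| = L2norm f.
Proof. exact: norm_nclass. Qed.

Lemma norm_L2pair_class f : `|L2pair_class f| = L2pair_norm f.
Proof. exact: norm_nclass. Qed.

Lemma L2norm_eq0 (f : Lfun2) : L2norm f = 0 <-> f = cst 0 %[ae mu].
Proof.
split=> [/fine_Lnormr_eq0 //|f0].
apply/eqP; rewrite -sqrf_eq0 L2norm_sqr /Rintegral.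
rewrite (@ae_eq_integral _ _ _ mu _ (cst 0)%E)// ?integral0//.
  by apply/measurable_EFinP; exact: measurable_funX.
by apply: filterS f0 => x /= f0 xT; rewrite f0// expr0n.
Qed.

Lemma L2classP (f g : Lfun2) : L2class f = L2class g <-> f = g %[ae mu].
Proof.
have h : L2class f = L2class g <-> f - g = cst 0 %[ae mu].
  by rewrite -L2norm_eq0; exact: nclassP.
rewrite h; split; apply: filterS => x /= xE xT; have /= := xE xT.
  by move/eqP; rewrite subr_eq0 => /eqP.
by move=> xe; rewrite -[LHS]/(f x - g x) xe subrr.
Qed.

Lemma L2pair_classP (f g : Lfun2 * Lfun2) :
  L2pair_class f = L2pair_class g <->
  (f.1 = g.1 %[ae mu]) /\ (f.2 = g.2 %[ae mu]).
Proof.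
rewrite -!L2classP.
have -> : L2pair_class f = L2pair_class g <-> L2pair_norm (f - g) = 0.
  exact: nclassP.
have -> : L2class f.1 = L2class g.1 <-> L2norm (f.1 - g.1) = 0 by exact: nclassP.
have -> : L2class f.2 = L2class g.2 <-> L2norm (f.2 - g.2) = 0 by exact: nclassP.
rewrite L2pair_normE /=; split=> [/eqP|[-> ->]]; last first.
  by rewrite expr0n addr0 sqrtr0.
rewrite sqrtr_eq0 => le0.
have /eqP : L2norm (f.1 - g.1) ^+ 2 + L2norm (f.2 - g.2) ^+ 2 = 0.
  by apply/le_anti; rewrite le0 addr_ge0 ?sqr_ge0.
by rewrite paddr_eq0 ?sqr_ge0// !sqrf_eq0 => /andP[/eqP -> /eqP ->].
Qed.

End L2.

Section Manifolds.
Context {R : realType}.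

(* L^2([0, 1]) is realized on Borel functions R -> R, integrated against the
   restriction of Lebesgue measure to [0, 1]; values outside [0, 1] are
   irrelevant. *)
Definition mu01 : {measure set (measurableTypeR R) -> \bar R} :=
  mrestr (@lebesgue_measure R) (measurable_itv `[0, 1]).

Definition L2_01 : normedModType R := L2space mu01.

Definition L2_01_R2 : normedModType R := L2pair_space mu01.

Definition u0 (x : R) : R := if x <= 0 then 1 else 0.

Lemma bounded01_Lfun (f : measurableTypeR R -> R) (c : R) :
  measurable_fun setT f -> (forall x : R, 0 <= x <= 1 -> `|f x| <= c) ->
  f \in Lfun mu01 2%:E.
Proof.
move=> mf fc.
have c0 : 0 <= c by rewrite (le_trans (normr_ge0 (f 0)))// fc// lexx ler01.
rewrite inE; apply/andP; split; rewrite inE//= /finite_norm unlock.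
apply: poweR_lty => /=.
apply: (@le_lt_trans _ _ (\int[mu01]_x (c `^ 2)%:E)%E).
  apply: ae_ge0_le_integral => //.
  - apply/measurable_EFinP.
    apply: (measurableT_comp (measurable_powR _)) => //.
    exact: measurableT_comp.
  - by move=> x _; rewrite lee_fin powR_ge0.
  - exists (~` `[0, 1]); split.
    + by apply: measurableC; exact: measurable_itv.
    + by rewrite /mu01 /= /mrestr setICl measure0.
    + move=> x /= /not_implyP[_ h] x01; apply: h.
      rewrite lee_fin ge0_ler_powR// ?nnegrE//.
      by apply: fc; move: x01; rewrite /= in_itv.
rewrite integral_cst// /mu01 /= /mrestr setTI.
by rewrite lebesgue_measure_itv /= lte_fin ltr01 -EFinB -EFinM ltry.
Qed.

Lemma measurable_u0 : measurable_fun [set: measurableTypeR R] u0.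
Proof.
by apply: measurable_fun_ifT => //; exact: measurable_fun_ler.
Qed.

Lemma u0_shift_Lfun (t : R) :
  ((fun x => u0 (x - t)) : measurableTypeR R -> R) \in Lfun mu01 2%:E.
Proof.
apply: (@bounded01_Lfun _ 1).
  apply: (measurableT_comp measurable_u0).
  exact: measurable_funB.
by move=> x _; rewrite /u0; case: ifP => _; rewrite ?normr1 ?normr0.
Qed.

Lemma u0_Lfun : (u0 : measurableTypeR R -> R) \in Lfun mu01 2%:E.
Proof.
apply: (@bounded01_Lfun _ 1); first exact: measurable_u0.
by move=> x _; rewrite /u0; case: ifP => _; rewrite ?normr1 ?normr0.
Qed.

Lemma line_Lfun (t : R) :
  ((fun x => x + t) : measurableTypeR R -> R) \in Lfun mu01 2%:E.
Proof.
apply: (@bounded01_Lfun _ (1 + `|t|)); first exact: measurable_funD.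
move=> x /andP[x0 x1]; rewrite (le_trans (ler_normD _ _))// lerD2r.
by rewrite ger0_norm.
Qed.

Definition eulerian_slice (t : R) : L2_01 :=
  L2class (Lfun_Sub (lee1n 2) (u0_shift_Lfun t)).

Definition lagrangian_slice (t : R) : L2_01_R2 :=
  L2pair_class
    (Lfun_Sub (lee1n 2) (line_Lfun t), Lfun_Sub (lee1n 2) u0_Lfun).

Definition eulerian_manifold : set L2_01 :=
  [set eulerian_slice t | t in `[0, 1]].

Definition lagrangian_manifold : set L2_01_R2 :=
  [set lagrangian_slice t | t in `[0, 1]].

End Manifolds.

Arguments eulerian_manifold : clear implicits.
Arguments lagrangian_manifold : clear implicits.

(* Main.v *)
(* (i) The differences of 2n + 1 equally spaced slices are 2n orthogonal
   vectors of squared norm 1/(2n).  By Bessel's inequality, the squared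
   distances of N orthogonal vectors of squared norm K to vectors of an
   n-dimensional space add up to at least (N - n) K, here 1/2, whereas
   approximating every slice within e makes this sum at most 2n (2e)^2; hence
   e >= 1 / (4 sqrt n).
   (ii) On [0, 1] the function u0 vanishes except at 0, so modulo null sets the
   Lagrangian slices are the vectors (x + t, 0), which lie in the span of
   (1, 0), (x, 0), ..., (x^(n-1), 0). *)
From HB Require Import structures.
Require Import Defs.
From mathcomp Require Import all_boot all_order all_algebra generic_quotient finmap.
From mathcomp Require Import all_classical all_reals all_analysis.
From mathcomp Require Import ring lra.

Set Implicit Arguments.
Unset Strict Implicit.
Unset Printing Implicit Defensive.

Import Order.TTheory GRing.Theory Num.Theory.
Local Open Scope ring_scope.

(** * Semi-inner products: deflation, Bessel's inequality, approximation from a span *)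

Section SemiInnerProduct.
Context (R : realFieldType) (V : lmodType R).

Record semi_inner (B : V -> V -> R) : Prop := SemiInner {
  inner_linear : forall a x y z, B (a *: x + y) z = a * B x z + B y z ;
  innerC : forall x y, B x y = B y x ;
  inner_ge0 : forall x, 0 <= B x x }.

Section Theory.
Variables (B : V -> V -> R) (hB : semi_inner B).

Lemma innerDl x y z : B (x + y) z = B x z + B y z.
Proof. by rewrite -[x]scale1r (inner_linear hB) scale1r mul1r. Qed.

Lemma inner0l z : B 0 z = 0.
Proof. by apply: (addIr (B 0 z)); rewrite -innerDl !add0r. Qed.

Lemma innerZl a x z : B (a *: x) z = a * B x z.
Proof. by rewrite -[a *: x]addr0 (inner_linear hB) inner0l addr0. Qed.

Lemma innerNl x z : B (- x) z = - B x z.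
Proof. by rewrite -scaleN1r innerZl mulN1r. Qed.

Lemma innerBl x y z : B (x - y) z = B x z - B y z.
Proof. by rewrite innerDl innerNl. Qed.

Lemma innerBr x y z : B z (x - y) = B z x - B z y.
Proof. by rewrite !(innerC hB z) innerBl. Qed.

Lemma innerZr a x z : B z (a *: x) = a * B z x.
Proof. by rewrite !(innerC hB z) innerZl. Qed.

Lemma inner_suml n (F : 'I_n -> V) z :
  B (\sum_i F i) z = \sum_i B (F i) z.
Proof.
by apply: (big_morph (B^~ z)) => [x y|]; rewrite ?innerDl ?inner0l.
Qed.

Lemma innerBB x y : B (x - y) (x - y) = B x x - 2 * B x y + B y y.
Proof. by rewrite innerBl !innerBr (innerC hB y x); ring. Qed.

(** If [B x y] were nonzero, [B (x - s *: y) (x - s *: y)] would be affine in [s] with nonzero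
    slope, hence negative somewhere. *)
Lemma inner_null x y : B y y = 0 -> B x y = 0.
Proof.
move=> y0; apply/eqP/negPn/negP => xy0.
(* This coefficient makes the square equal to -1. *)
have := inner_ge0 hB (x - ((B x x + 1) / (2 * B x y)) *: y).
rewrite innerBB !innerZr innerZl y0 !mulr0 addr0.
have -> : 2 * ((B x x + 1) / (2 * B x y) * B x y) = B x x + 1 by field.
by rewrite opprD addrA subrr add0r oppr_ge0 ler10.
Qed.

(* If [B b b = 0] the divisions by zero below make this [B] itself. *)
Definition deflate b x y := B x y - B x b * B y b / B b b.

Lemma deflateE b x y :
  deflate b x y = B x (y - (B y b / B b b) *: b).
Proof. by rewrite innerBr innerZr /deflate; congr (_ - _); ring. Qed.

(** The deflated square is the square of the residual of [x] after projection on [b], so deflation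
    preserves nonnegativity. *)
Lemma deflate_diagE b x :
  deflate b x x =
  B (x - (B x b / B b b) *: b) (x - (B x b / B b b) *: b).
Proof.
rewrite innerBB !innerZr innerZl /deflate.
have [->|b0] := eqVneq (B b b) 0; first by rewrite invr0 !mulr0 !mul0r; ring.
by field.
Qed.

Lemma semi_inner_deflate b : semi_inner (deflate b).
Proof.
split=> [a x y z|x y|x].
- by rewrite /deflate !(inner_linear hB); ring.
- by rewrite /deflate (innerC hB x y); congr (_ - _); ring.
- by rewrite deflate_diagE inner_ge0.
Qed.

Lemma deflate_diagB b a x :
  deflate b (x - a *: b) (x - a *: b) = deflate b x x.
Proof.
rewrite /deflate innerBB !innerBl !innerZr !innerZl.
have [b0|b0] := eqVneq (B b b) 0; last by field.
by rewrite (inner_null x b0) b0 invr0; ring.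
Qed.

Lemma deflate_le b x : deflate b x x <= B x x.
Proof.
by rewrite gerDl oppr_le0 -expr2 divr_ge0 ?sqr_ge0 ?(inner_ge0 hB).
Qed.

(** The projection [p] of [x] on the span of [phi] satisfies [B p x = B p p = S / K]; nonnegativity
    of the square of [x - p] then gives the bound. *)
Lemma bessel N (phi : 'I_N -> V) (K : R) (x : V) : 0 < K ->
  (forall j k, B (phi j) (phi k) = if j == k then K else 0) ->
  \sum_j B (phi j) x ^+ 2 <= K * B x x.
Proof.
move=> K0 orth; set S := \sum_j _.
pose p := \sum_j (B (phi j) x / K) *: phi j.
have pE z : B p z = \sum_j B (phi j) x / K * B (phi j) z.
  by rewrite inner_suml; apply: eq_bigr => j _; rewrite innerZl.
have px : B p x = S / K.
  by rewrite pE mulr_suml; apply: eq_bigr => j _; rewrite expr2 mulrAC.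
have pp : B p p = S / K.
  rewrite pE mulr_suml; apply: eq_bigr => j _.
  rewrite (innerC hB _ p) pE (bigD1 j)//= orth eqxx big1 => [|k kj].
    by field; rewrite gt_eqF.
  by rewrite orth (negPf kj) mulr0.
have := inner_ge0 hB (x - p).
rewrite innerBB (innerC hB x p) px pp => h.
have : S / K <= B x x by lra.
by rewrite ler_pdivrMr// mulrC.
Qed.

End Theory.

(* Replacing [B] by [deflate B b], with [b] the last generator, makes [b] null,
   preserves the Bessel inequality and costs at most [K] in the sum of the
   [B (phi j) (phi j)]; this is the induction step. *)
Lemma span_approx_ge (B : V -> V -> R) (hB : semi_inner B)
    N (phi : 'I_N -> V) (K : R) :
  0 <= K -> (forall x, \sum_j B (phi j) x ^+ 2 <= K * B x x) ->
  forall n (b : 'I_n -> V) (a : 'I_N -> 'I_n -> R),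
  \sum_j B (phi j) (phi j) - n%:R * K <=
  \sum_j B (phi j - \sum_i a j i *: b i) (phi j - \sum_i a j i *: b i).
Proof.
move=> K0 + n; elim: n => [|n IH] in B hB * => bes b a.
  by rewrite mul0r subr0; apply: ler_sum => j _; rewrite big_ord0 subr0.
set q := b ord_max.
have hD := semi_inner_deflate hB q.
(* This is the hypothesis [bes] at the residual of [x] after projection on [q]. *)
have besD x : \sum_j deflate B q (phi j) x ^+ 2 <= K * deflate B q x x.
  rewrite (deflate_diagE hB).
  under eq_bigr do rewrite (deflateE hB).
  exact: bes.
apply: (@le_trans _ _ (\sum_j deflate B q (phi j) (phi j) - n%:R * K)).
  rewrite /deflate sumrB -natr1 mulrDl mul1r.
  (* The loss caused by deflation is bounded by [bes] at [q] itself. *)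
  suff : \sum_j B (phi j) q * B (phi j) q / B q q <= K by lra.
  rewrite -mulr_suml.
  have [->|q0] := eqVneq (B q q) 0; first by rewrite invr0 mulr0.
  rewrite ler_pdivrMr ?lt0r ?q0 ?(inner_ge0 hB)//.
  exact: bes.
apply: (le_trans (IH _ hD besD (fun i => b (widen_ord (leqnSn n) i))
  (fun j i => a j (widen_ord (leqnSn n) i)))).
apply: ler_sum => j _.
(* The multiple of [q] is invisible to the deflated form, so it can be restored before returning to
   [B]. *)
rewrite big_ord_recr /= -/q opprD addrA -(deflate_diagB hB _ (a j ord_max)).
exact: deflate_le.
Qed.

End SemiInnerProduct.

(** * The L^2 semi-inner product on functions *)

Section L2Inner.
Context d (T : measurableType d) (R : realType) (mu : {measure set T -> \bar R}).

Definition L2inner (f g : Lfun2 mu) : R := \int[mu]_x (f x * g x).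

Lemma L2inner_integrable (f g : Lfun2 mu) :
  mu.-integrable setT (EFin \o (fun x => f x * g x)).
Proof. by apply/Lfun1_integrable; apply: Lfun2_mul_Lfun1; exact: LfunP. Qed.

Lemma L2inner_sqr (f : Lfun2 mu) : L2inner f f = L2norm f ^+ 2.
Proof. by rewrite L2norm_sqr; apply: eq_Rintegral. Qed.

Lemma semi_inner_L2 : semi_inner L2inner.
Proof.
split=> [a f g h|f g|f].
- rewrite /L2inner -RintegralZl ?L2inner_integrable//.
  rewrite -RintegralD ?L2inner_integrable//.
    by apply: eq_Rintegral => x _ /=; rewrite mulrDl mulrA.
  have := L2inner_integrable (a *: f) h.
  by congr integrable; apply/funext => x /=; rewrite mulrA.
- by apply: eq_Rintegral => x _; rewrite mulrC.
- by rewrite L2inner_sqr sqr_ge0.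
Qed.

End L2Inner.

(** * Gram matrix of the Eulerian slices and of their differences *)

Section Euler.
Context (R : realType).

Definition eulerian_fun (t : R) : Lfun2 (@mu01 R) :=
  Lfun_Sub (lee1n 2) (u0_shift_Lfun t).

(** The product of the two steps is the indicator of the half-line up to [Num.min s t], which meets
    [0, 1] in an interval of that length. *)
Lemma L2inner_eulerian (s t : R) : 0 <= s <= 1 -> 0 <= t <= 1 ->
  L2inner (eulerian_fun s) (eulerian_fun t) = Num.min s t.
Proof.
move=> /andP[s0 s1] /andP[t0 t1]; rewrite /L2inner /Rintegral.
set m := Num.min s t.
have m01 : 0 <= m <= 1 by rewrite le_min ge_min s0 t0 s1.
rewrite (_ : (fun x => _) = fun x => (\1_([set` `]-oo, m]] : set R) x)%:E); last first.
  apply/funext => x /=; rewrite indicE mem_setE in_itv /= /m le_min /u0 !subr_le0.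
  by case: (x <= s); case: (x <= t); rewrite ?mulr1 ?mulr0 ?mul0r.
rewrite integral_indic//.
have mE : (`]-oo, m] `&` `[0, 1] = `[0, m] :> set R)%classic.
  apply/seteqP; split=> x /=; rewrite !in_itv /=; first by move=> [-> /andP[->]].
  move=> /andP[x0 xm]; split=> //; rewrite x0 (le_trans xm)//.
  by case/andP: m01.
rewrite setIT; transitivity (fine (lebesgue_measure (`[0, m]%classic : set R))).
  by rewrite -mE.
rewrite lebesgue_measure_itv /= lte_fin.
by case: ltgtP m01 => //= _ _; rewrite oppr0 addr0.
Qed.

(** The inner product is a mixed second difference of [Num.min]. For [j < k] one has [j.+1 <= k], so
    each minimum is its first argument and the differences cancel. *)
Lemma eulerian_steps_orthogonal (N : nat) (j k : 'I_N) :
  let t i : R := i%:R / N%:R in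
  let phi (i : 'I_N) := eulerian_fun (t i.+1) - eulerian_fun (t i) in
  L2inner (phi j) (phi k) = if j == k then N%:R^-1 else 0.
Proof.
have hB := semi_inner_L2 (@mu01 R).
move=> t phi.
have N0 : 0 < N%:R :> R by rewrite ltr0n; case: N j {k t phi} => // -[].
have t01 i : (i <= N)%N -> 0 <= t i <= 1.
  by move=> iN; rewrite divr_ge0 //= ler_pdivrMr// mul1r ler_nat.
have tS i : t i.+1 = t i + N%:R^-1 by rewrite /t -natr1 mulrDl mul1r.
have tle i l : (i <= l)%N -> t i <= t l.
  by move=> il; rewrite ler_pM2r ?invr_gt0// ler_nat.
have jN := ltn_ord j; have kN := ltn_ord k.
rewrite (innerBl hB) !(innerBr hB) !L2inner_eulerian ?t01 // 1?ltnW //.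
case: eqVneq => [->|jk].
  by rewrite !minxx !tS minC (min_l (x := t k)); [ring|rewrite lerDl invr_ge0 ltW].
have /orP[jlk|klj] : (j < k)%N || (k < j)%N by rewrite -neq_ltn.
- rewrite !min_l ?tle ?subrr// 1?ltnW // ltnS ltnW //.
- rewrite !min_r ?tle ?subrr// 1?ltnW // ltnS ltnW //.
Qed.

End Euler.

(** * Transfer between functions and their L^2 classes *)

Section Class.
Context d (T : measurableType d) (R : realType) (mu : {measure set T -> \bar R}).

Lemma L2class_surj (u : L2space mu) : exists f, L2class f = u.
Proof. by exists (repr u); exact: reprK. Qed.

Lemma norm_L2class_sub (f g : Lfun2 mu) :
  `|L2class f - L2class g| = L2norm (f - g).
Proof. by rewrite -scaleN1r -nclassZ -nclassD norm_nclass scaleN1r. Qed.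

Lemma L2class_sum n (a : 'I_n -> R) (b : 'I_n -> Lfun2 mu) :
  \sum_i a i *: L2class (b i) = L2class (\sum_i a i *: b i).
Proof.
rewrite (big_morph (@L2class _ _ _ mu) (id1 := 0) (op1 := +%R)) //.
- by apply: eq_bigr => i _; rewrite [RHS]nclassZ.
- exact: nclassD.
Qed.

End Class.

(** * Lower bound for the Eulerian width *)

Section Lower.
Context (R : realType).

Lemma eulerian_approx_ge (n : nat) (b : 'I_n -> L2_01) (e : R) : (0 < n)%N ->
  (forall t : R, 0 <= t <= 1 -> exists2 v, lin_span b v & `|eulerian_slice t - v| < e) ->
  1 < 16 * n%:R * e ^+ 2.
Proof.
move=> n0 app; set N := (2 * n)%N.
have Npos : (0 < N)%N by rewrite muln_gt0.
have N0 : 0 < N%:R :> R by rewrite ltr0n.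
have NE : N%:R = 2 * n%:R :> R by rewrite -natrM.
have [g gE] := choice (fun i => L2class_surj (b i)).
have hB := semi_inner_L2 (@mu01 R).
pose t (i : nat) : R := i%:R / N%:R.
(* Coefficients are indexed by all naturals, with the default 0 past [N], so that [c j] and [c j.+1]
   need no ordinal casts. *)
have /choice[c cP] (i : nat) : exists c : 'I_n -> R, (i <= N)%N ->
    L2norm (eulerian_fun (t i) - \sum_k c k *: g k) < e.
  have [iN|] := boolP (i <= N)%N; last by move=> _; exists (fun=> 0).
  have [|v [c ->] h] := app (t i).
    by rewrite divr_ge0 //= ler_pdivrMr// mul1r ler_nat.
  exists c => _; rewrite -norm_L2class_sub -L2class_sum.
  by under eq_bigr do rewrite gE.
pose phi (j : 'I_N) := eulerian_fun (t j.+1) - eulerian_fun (t j).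
have orth j k : L2inner (phi j) (phi k) = if j == k then N%:R^-1 else 0.
  exact: eulerian_steps_orthogonal.
have Ni0 : 0 < N%:R^-1 :> R by rewrite invr_gt0.
have := span_approx_ge hB (ltW Ni0) (fun x => bessel hB x Ni0 orth) g
  (fun j k => c j.+1 k - c j k).
under eq_bigr do rewrite orth eqxx.
rewrite sumr_const card_ord -[_ *+ N]mulr_natl mulfV ?gt_eqF// => le_sum.
have lt_term (j : 'I_N) :
    L2inner (phi j - \sum_i (c j.+1 i - c j i) *: g i)
            (phi j - \sum_i (c j.+1 i - c j i) *: g i) < (2 * e) ^+ 2.
  rewrite L2inner_sqr ltrXn2r ?nnegrE ?L2norm_ge0//.
  (* The error for [phi j] is the difference of the errors of two consecutive slices, each below
     [e]. *)
  rewrite (_ : _ - _ = (eulerian_fun (t j.+1) - \sum_k c j.+1 k *: g k)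
     + (-1) *: (eulerian_fun (t j) - \sum_k c j k *: g k)); last first.
    rewrite scaleN1r /phi; under eq_bigr do rewrite scalerBl.
    by rewrite sumrB !opprB [X in _ + X = _]addrC addrACA; congr (_ + _); rewrite addrC.
  apply: le_lt_trans (seminormD (L2seminorm _) _ _) _.
  rewrite seminormZ normrN1 mul1r (_ : 2 * e = e + e); last by ring.
  rewrite ltrD ?cP//.
  exact: ltnW.
have : 1 - n%:R * N%:R^-1 < \sum_(j < N) (2 * e) ^+ 2.
  apply: le_lt_trans le_sum _.
  apply: ltr_sum => //.
  by apply/hasP; exists (Ordinal Npos) => //; rewrite mem_index_enum.
rewrite sumr_const card_ord -[_ ^+ 2 *+ N]mulr_natl (_ : 1 - _ = 2^-1); last first.
  by rewrite NE; field; rewrite pnatr_eq0 -lt0n.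
by rewrite NE; lra.
Qed.

Lemma eulerian_width_ge (n : nat) : (0 < n)%N ->
  ((4^-1 * n%:R `^ (- 2^-1))%:E <= kolmogorov_width n (eulerian_manifold R))%E.
Proof.
move=> n0; apply/ereal_infP => _ [V [b [_ ->]] <-].
rewrite leNgt; apply/negP => devlt; set e := 4^-1 * _ in devlt.
have /(eulerian_approx_ge n0) : forall t : R, 0 <= t <= 1 ->
    exists2 v, lin_span b v & `|eulerian_slice t - v| < e.
  move=> t t01.
  have : (dist_to_set (lin_span b) (eulerian_slice t) < e%:E)%E.
    apply: le_lt_trans devlt; apply: ereal_sup_ubound.
    by exists (eulerian_slice t) => //; exists t.
  by move=> /ereal_inf_lt[_ [v Vv <-]]; rewrite lte_fin; exists v.
(* Here [e ^+ 2] is 1/(16 n), so the strict bound becomes 1 < 1. *)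
rewrite /e exprMn powRN powR12_sqrt// !exprVn sqr_sqrtr//.
have nn : n%:R != 0 :> R by rewrite pnatr_eq0 -lt0n.
by rewrite (_ : 16 * _ * _ = 1) ?ltxx//; field.
Qed.

End Lower.

(** * Vanishing of the Lagrangian width *)

Section Lagrange.
Context (R : realType).

(** A measurable null cover of [A] is its countable part in [0, 1] together with the complement of
    [0, 1], which [mu01] does not charge. *)
Lemma mu01_negligible (A : set R) :
  countable (A `&` `[0, 1]%classic)%classic -> (@mu01 R).-negligible A.
Proof.
move=> cA; exists (A `&` `[0%R, 1%R] `|` ~` `[0%R, 1%R])%classic; split.
- apply: measurableU; first by apply: countable_measurable.
  by apply: measurableC; exact: measurable_itv.
- rewrite /mu01 /= /mrestr setIUl setICl setU0 -setIA setIid.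
  exact: countable_lebesgue_measure0.
- by move=> x Ax; have [x01|x01] := pselect (`[0, 1]%classic x); [left|right].
Qed.

Lemma horner_Lfun (p : {poly R}) :
  (horner p : measurableTypeR R -> R) \in Lfun (@mu01 R) 2%:E.
Proof.
apply: (@bounded01_Lfun _ _ (\sum_(i < size p) `|p`_i|)).
  exact: measurable_poly.
move=> x /andP[x0 x1]; rewrite horner_coef.
apply: (le_trans (ler_norm_sum _ _ _)); apply: ler_sum => i _.
by rewrite normrM normrX (ger0_norm x0) ler_piMr// exprn_ile1.
Qed.

(** Linear and injective, this map reduces independence and span membership in L^2 to coefficients
    of polynomials. *)
Definition poly_class (p : {poly R}) : L2_01_R2 :=
  L2pair_class (Lfun_Sub (lee1n 2) (horner_Lfun p), 0).

Lemma poly_class_is_linear : linear poly_class.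
Proof.
move=> a p q; rewrite /poly_class /L2pair_class -nclassZ -nclassD.
apply/L2pair_classP; split; apply: nearW => x _ /=.
  by rewrite hornerD hornerZ.
by rewrite scaler0 addr0.
Qed.

HB.instance Definition _ :=
  GRing.isLinear.Build R {poly R} L2_01_R2 *:%R poly_class poly_class_is_linear.

Lemma finite_roots (p : {poly R}) : p != 0 ->
  finite_set [set x : R | root p x]%classic.
Proof.
move=> p0; apply: contrapT => /(@infinite_set_fset _ _ (size p))[rs rsp].
rewrite leqNgt (max_poly_roots p0) ?fset_uniq//.
by apply/allP => x xrs; exact: rsp.
Qed.

(** For nonzero [p] the roots are finite in number, hence null; the non-roots are null by
    assumption, yet the total mass is 1. *)
Lemma poly_class_eq0 (p : {poly R}) : poly_class p = 0 -> p = 0.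
Proof.
rewrite -(linear0 poly_class) => /L2pair_classP[/= + _] => pN.
apply/eqP/negPn/negP => p0.
have rN : (@mu01 R).-negligible [set x : R | root p x]%classic.
  apply: mu01_negligible; apply: finite_set_countable.
  exact: finite_setIl (finite_roots p0).
have := negligibleU rN pN.
rewrite (_ : (_ `|` _)%classic = setT).
  move/negligibleP => /(_ measurableT).
  rewrite /mu01 /= /mrestr setTI lebesgue_measure_itv /= lte_fin ltr01.
  by rewrite oppr0 adde0 => /eqP; rewrite eqe oner_eq0.
apply/seteqP; split=> // x _; have [px|px] := boolP (root p x); first by left.
right => /= /(_ I); rewrite horner0 => px0.
by move: px; rewrite rootE px0 eqxx.
Qed.

Lemma lagrangian_slice_poly (t : R) :
  lagrangian_slice t = poly_class ('X + t%:P).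
Proof.
apply/L2pair_classP; split => /=.
  by apply: nearW => x _ /=; rewrite hornerD hornerX hornerC.
apply: mu01_negligible; apply: (@sub_countable _ _ _ [set 0 : R]%classic).
  apply: subset_card_le => x /= [/not_implyP[_]].
  rewrite in_itv /= /u0; case: ifP => // x0 _ /andP[x0' _].
  by apply/eqP; rewrite eq_le x0 x0'.
exact: finite_set_countable.
Qed.

Lemma lagrangian_width0 (n : nat) : (2 <= n)%N ->
  kolmogorov_width n (lagrangian_manifold R) = 0%E.
Proof.
move=> n2; apply/le_anti/andP; split; last first.
  apply/ereal_infP => _ [V _ <-].
  (* A supremum over an empty set would be -oo, so nonnegativity needs an actual slice. *)
  apply: (@le_trans _ _ (dist_to_set V (lagrangian_slice 0))).
    by apply/ereal_infP => _ [v _ <-]; rewrite lee_fin.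
  apply: ereal_sup_ubound; exists (lagrangian_slice 0) => //.
  by exists 0 => //; rewrite /= in_itv /= lexx ler01.
pose b (i : 'I_n) := poly_class 'X^i.
have sumE (a : 'I_n -> R) :
    \sum_i a i *: b i = poly_class (\sum_i a i *: 'X^i).
  by rewrite linear_sum; apply: eq_bigr => i _; rewrite linearZ.
have freeb : lin_indep b.
  move=> a; rewrite sumE => /poly_class_eq0 p0 i.
  have := congr1 (fun p : {poly R} => p`_i) p0.
  rewrite coef0 coef_sum (bigD1 i)//= coefZ coefXn eqxx mulr1 big1 ?addr0//.
  by move=> j ji; rewrite coefZ coefXn val_eqE eq_sym (negPf ji) mulr0.
apply: (@le_trans _ _ (deviation (lagrangian_manifold R) (lin_span b))).
  by apply: ereal_inf_lbound; exists (lin_span b) => //; exists b.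
apply/ereal_supP => _ [_ [t _ <-] <-].
apply: ereal_inf_lbound; exists (lagrangian_slice t); last by rewrite subrr normr0.
rewrite lagrangian_slice_poly; exists (fun i => ('X + t%:P)`_i).
rewrite sumE -poly_def; congr poly_class; apply/polyP => i; rewrite coef_poly.
(* ['X + t%:P] has size 2, so [2 <= n] kills its coefficients from index [n] on. *)
case: ltnP => // ni; rewrite nth_default ?size_XaddC//; exact: leq_trans ni.
Qed.

End Lagrange.

Theorem theorem1 (R : realType) :
  (exists2 c : R, 0 < c &
    forall n : nat, (1 <= n)%N ->
      ((c * n%:R `^ (- 2^-1))%:E <= kolmogorov_width n (eulerian_manifold R))%E)
  /\
  (forall n : nat, (2 <= n)%N ->
      kolmogorov_width n (lagrangian_manifold R) = 0%E).
Proof.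
split; last exact: lagrangian_width0.
by exists 4^-1; [rewrite invr_gt0 | exact: eulerian_width_ge].
Qed.
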